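(* Let $S$ be a finite subset of the vertex set $V$ of an infinite locally finite graph $G=(V,E)$, with the induced subgraph on $S$ connected. Let $Q:\bar S\to\mathbb{R}$ satisfy $\int_S Q\ne 0$, and let $\lambda_1\le\lambda_2\le\dots\le\lambda_{|S|}$ be the eigenvalues, listed in non-decreasing order with multiplicity, of $L=-\Delta+Q$ on $S$ with the Neumann boundary condition. Then for each $j\in\{1,\dots,\#S\}$ (where the index $|S|$ in the list $\lambda_1\le\lambda_2\le\dots\le\lambda_{|S|}$ denotes the number $\#S$ of vertices in $S$), $\lambda_j$ is the minimal number among all $\lambda\in\mathbb{R}$ such that the level set $$P_\lambda=\{[f]\in P(X): E(f)\le\lambda\}\subset P(X)$$ contains a projective subspace of dimension $j-1$.
   Context: $G$ is locally finite: there is $c>0$ with $d_x:=\#\{y\in V: y\sim x\}\le c$ for all $x$, where $x\sim y$ means that $x,y$ are joined by an edge. $\delta S$ is the set of vertices not in $S$ that are adjacent to some vertex of $S$, and $\bar S=S\cup\delta S$. Integration: $\int_S f=\int_S f\,dx=\sum_{x\in S}f(x)d_x$. Laplacian: $\Delta f(x)=\frac1{d_x}\sum_{y\sim x}(f(y)-f(x))$ for $x\in S$. A function $f:\bar S\to\mathbb{R}$ satisfies the Neumann boundary condition if $\sum_{y\in S,\,y\sim x}(f(y)-f(x))=0$ for every $x\in\delta S$. Every function on $S$ has a unique extension to $\bar S$ satisfying this condition, and $Lf=-\Delta f+Qf$ on $S$ is computed with this extension. An eigenvalue is a number $\lambda$ for which there is a nonzero $f$ with $Lf=\lambda f$ in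 $S$. $X=H^1(S)$ is the space of all real functions on $S$ (understood with the Neumann extension), $P(X)=(X\setminus\{0\})/(\mathbb{R}\setminus\{0\})$ is its projective space, and $E(f)=\dfrac{\int_S f\,Lf\,dx}{\int_S f^2\,dx}$ for $f\in X\setminus\{0\}$, which is well defined on $P(X)$. A projective subspace of dimension $j-1$ is the image in $P(X)$ of $Y\setminus\{0\}$ for a linear subspace $Y\subset X$ of dimension $j$. *)

(* Defs.v *)
From HB Require Import structures.
From mathcomp Require Import all_boot all_order all_algebra finmap.
From mathcomp Require Import boolp classical_sets cardinality reals.

Set Implicit Arguments.
Unset Strict Implicit.
Unset Printing Implicit Defensive.

Import Order.TTheory GRing.Theory Num.Theory.

Local Open Scope classical_set_scope.
Local Open Scope fset_scope.
Local Open Scope ring_scope.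

(* Simple graph with finite neighbourhoods; [y \in nbrs G x] is adjacency. *)
Record graph (V : choiceType) := Graph {
  nbrs : V -> {fset V};
  nbrs_sym : forall x y, (y \in nbrs x) = (x \in nbrs y);
  nbrs_irr : forall x, x \notin nbrs x
}.

Section Graph.
Context {V : choiceType} (G : graph V).

Definition deg (x : V) : nat := #|` nbrs G x|.

(* Finiteness of each neighbourhood is part of [graph]; what is left is the
   uniform bound on the degrees. *)
Definition locally_finite : Prop :=
  exists2 c : nat, (0 < c)%N & forall x, (deg x <= c)%N.

Definition induced_connected (S : {fset V}) : Prop :=
  forall x y : S, connect (fun u v : S => val v \in nbrs G (val u)) x y.

Definition vboundary (S : {fset V}) : {fset V} :=
  (\bigcup_(x <- S) nbrs G x) `\` S.

Definition vclosure (S : {fset V}) : {fset V} := S `|` vboundary S.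

Definition inS (S : {fset V}) : S -> vclosure S := fincl (fsubsetUl S (vboundary S)).
Definition inB (S : {fset V}) : vboundary S -> vclosure S :=
  fincl (fsubsetUr S (vboundary S)).

Lemma boundary_nbr (S : {fset V}) (x : vboundary S) :
  exists y : S, val y \in nbrs G (val x).
Proof.
have := valP x; rewrite in_fsetD => /andP[_ /bigfcupP[y /andP[yS _] xy]].
by exists [` yS]; rewrite /= nbrs_sym.
Qed.

Lemma closureP (S : {fset V}) (z : vclosure S) :
  (exists x : S, z = inS x) \/ (exists x : vboundary S, z = inB x).
Proof.
have := valP z; rewrite in_fsetU => /orP[] zS.
  by left; exists [` zS]; apply: val_inj.
by right; exists [` zS]; apply: val_inj.
Qed.

End Graph.

Section Neumann.
Context {R : realType} {V : choiceType} (G : graph V) (S : {fset V}).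

Definition gintegral (f : S -> R) : R :=
  \sum_(x : S) f x * (deg G (val x))%:R.

Definition laplacian (f : vclosure G S -> R) (x : S) : R :=
  (deg G (val x))%:R^-1 *
  \sum_(y : vclosure G S | val y \in nbrs G (val x)) (f y - f (inS G x)).

Definition neumann (f : vclosure G S -> R) : Prop :=
  forall x : vboundary G S,
    \sum_(y : S | val y \in nbrs G (val x)) (f (inS G y) - f (inB x)) = 0.

Definition is_neumann_ext (f : {ffun S -> R^o}) (g : {ffun vclosure G S -> R^o}) :
  Prop := (forall x : S, g (inS G x) = f x) /\ neumann g.

Definition neumann_ext (f : {ffun S -> R^o}) : {ffun vclosure G S -> R^o} :=
  xget 0 [set g | is_neumann_ext f g].

Let nnbr (x : V) : nat := #|[pred y : S | val y \in nbrs G x]|.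

Let nnbr_neq0 (x : vboundary G S) : (nnbr (val x))%:R != 0 :> R.
Proof.
rewrite pnatr_eq0 -lt0n; have [y yx] := boundary_nbr x.
by apply/card_gt0P; exists y.
Qed.

Let neumannE (g : vclosure G S -> R) : neumann g <-> forall x : vboundary G S,
  g (inB x) = (nnbr (val x))%:R^-1 *
    \sum_(y : S | val y \in nbrs G (val x)) g (inS G y).
Proof.
have E (x : vboundary G S) :
    \sum_(y : S | val y \in nbrs G (val x)) (g (inS G y) - g (inB x)) =
    \sum_(y : S | val y \in nbrs G (val x)) g (inS G y)
    - (nnbr (val x))%:R * g (inB x).
  by rewrite sumrB sumr_const mulr_natl.
split=> H x; have := H x; rewrite E.
  by move/subr0_eq ->; rewrite (mulKf (nnbr_neq0 x)).
by move=> ->; rewrite (mulVKf (nnbr_neq0 x)) subrr.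
Qed.

Lemma neumann_ext_exists (f : {ffun S -> R^o}) : exists g, is_neumann_ext f g.
Proof.
pose g : {ffun vclosure G S -> R^o} := [ffun z =>
  if insub (val z) : {? x | x \in S} is Some x then f [` valP x]
  else (nnbr (val z))%:R^-1 * \sum_(y : S | val y \in nbrs G (val z)) f y].
have gS x : g (inS G x) = f x.
  rewrite ffunE; case: insubP => [u _ /= e|]; last by rewrite /= (valP x).
  by congr (f _); apply: val_inj; rewrite /= e.
exists g; split=> //; apply/neumannE => x.
rewrite {1}/g ffunE insubF /=; last first.
  by have := valP x; rewrite in_fsetD => /andP[/negbTE].
by congr (_ * _); apply: eq_bigr => y _; rewrite gS.
Qed.

Lemma neumann_ext_unique (f : {ffun S -> R^o}) g h :
  is_neumann_ext f g -> is_neumann_ext f h -> g = h.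
Proof.
move=> [gS /neumannE gB] [hS /neumannE hB]; apply/ffunP => z.
have [[x ->]|[x ->]] := closureP z; first by rewrite gS hS.
rewrite gB hB; congr (_ * _).
by apply: eq_bigr => y _; rewrite gS hS.
Qed.

Lemma neumann_extP (f : {ffun S -> R^o}) : is_neumann_ext f (neumann_ext f).
Proof. exact: (xgetPex 0 (neumann_ext_exists f)). Qed.

Lemma neumann_ext_linear : linear neumann_ext.
Proof.
move=> a f g; apply: (neumann_ext_unique (neumann_extP _)).
have [[fS /neumannE fB] [gS /neumannE gB]] := (neumann_extP f, neumann_extP g).
split=> [x|]; first by rewrite !ffunE fS gS.
apply/neumannE => x; rewrite !ffunE fB gB scalerAr -mulrDr; congr (_ * _).
rewrite scaler_sumr -big_split /=.
by apply: eq_bigr => y _; rewrite !ffunE.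
Qed.

Definition schrodinger (Q : vclosure G S -> R) (f : {ffun S -> R^o}) :
    {ffun S -> R^o} :=
  [ffun x => - laplacian (neumann_ext f) x + Q (inS G x) * f x].

Lemma schrodinger_linear Q : linear (schrodinger Q).
Proof.
move=> a f g; apply/ffunP => x; rewrite !ffunE /laplacian neumann_ext_linear.
have -> : \sum_(y : vclosure G S | val y \in nbrs G (val x))
    ((a *: neumann_ext f + neumann_ext g) y -
     (a *: neumann_ext f + neumann_ext g) (inS G x)) =
  a * \sum_(y : vclosure G S | val y \in nbrs G (val x))
    (neumann_ext f y - neumann_ext f (inS G x)) +
  \sum_(y : vclosure G S | val y \in nbrs G (val x))
    (neumann_ext g y - neumann_ext g (inS G x)).
  rewrite mulr_sumr -big_split /=; apply: eq_bigr => y _; rewrite !ffunE.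
  by rewrite /GRing.scale /= mulrBr opprD addrACA.
rewrite /GRing.scale /= !mulrDr opprD addrACA; congr (_ + _); last first.
by congr (_ + _); [rewrite mulrN mulrCA|rewrite mulrCA].
Qed.

HB.instance Definition _ Q :=
  GRing.isLinear.Build R {ffun S -> R^o} {ffun S -> R^o} *:%R
    (schrodinger Q) (schrodinger_linear Q).

(* [lam] lists the eigenvalues in non-decreasing order, each as many times as
   the dimension of its eigenspace. *)
Definition eigenvalue_list (Q : vclosure G S -> R) (lam : seq R) : Prop :=
  [/\ sorted <=%R lam,
      size lam = #|` S| &
      forall mu : R,
        count_mem mu lam = \dim (passmx.leigenspace (linfun (schrodinger Q)) mu)].

Definition energy (Q : vclosure G S -> R) (f : {ffun S -> R^o}) : R :=
  gintegral (fun x => f x * schrodinger Q f x) / gintegral (fun x => f x ^+ 2).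

End Neumann.

(* [P(X) = (X \ 0) / (R \ 0)]: a point is the orbit of a nonzero vector under
   nonzero scalars, so that subsets of [P(X)] have type [set (set X)]. *)
Section Projective.
Context {F : fieldType} {X : vectType F}.

Definition proj_class (f : X) : set X := [set g | exists2 a : F, a != 0 & g = a *: f].

Definition proj_image (A : set X) : set (set X) :=
  [set proj_class f | f in [set f | A f /\ f != 0]].

Definition is_proj_subspace (k : nat) (P : set (set X)) : Prop :=
  exists2 Y : {vspace X}, \dim Y = k.+1 & P = proj_image [set f | f \in Y].

End Projective.

Section LevelSet.
Context {R : realType} {V : choiceType} {G : graph V} {S : {fset V}}.

Definition level_set (Q : vclosure G S -> R) (lam : R) :
    set (set {ffun S -> R^o}) :=
  proj_image [set f | energy Q f <= lam].

End LevelSet.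

(* Main.v *)
Require Import Defs.
From mathcomp Require Import all_boot all_order all_algebra finmap.
From mathcomp Require Import boolp classical_sets cardinality reals.
From mathcomp Require Import complex zify.

Set Implicit Arguments.
Unset Strict Implicit.
Unset Printing Implicit Defensive.

Import Order.TTheory GRing.Theory Num.Theory.
Import passmx.

Local Open Scope classical_set_scope.
Local Open Scope ring_scope.

(** The operator [schrodinger Q] is self-adjoint for the inner product
    [B f g = gintegral (f * g)] on the functions on [S], and the energy is its
    Rayleigh quotient [B f (L f) / B f f], so the statement is the
    Courant-Fischer min-max principle.

    Self-adjointness ([schrodinger_self_adjoint]) is Green's formula without a
    boundary term. Multiplying by the degree cancels the [1 / d_x] of the
    Laplacian, and the sum over [S] may be extended to the whole closure,
    because the Neumann condition annihilates what each boundary vertex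
    contributes. What remains is a sum over the ordered pairs of adjacent
    vertices that touch [S], a set of pairs stable under exchange. The form [B]
    is positive definite because all degrees in [S] are positive: as [S] is
    connected, a vertex of degree zero would be all of [S], and then every
    integral over [S] would vanish ([deg_gt0_of_gintegral]).

    A list of eigenvalues with multiplicity, as long as the dimension, exists
    because a self-adjoint operator is diagonalizable over the reals
    ([self_adjoint_mx_diagonalizable]): the complex roots of its minimal
    polynomial are real, and they are simple since [(T - r)^2 u = 0] forces
    [(T - r) u = 0].

    For the min-max principle, distinct eigenspaces are orthogonal, so the sum
    of the eigenspaces for the eigenvalues that satisfy a predicate [P] has as
    dimension the number of entries of the list that satisfy [P]
    ([dim_leigenspace_count]), and on it the quadratic form is bounded by the
    extreme eigenvalues. Taking the eigenvalues [<= lambda_j] gives a space of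
    dimension at least [j] on which the quotient is at most [lambda_j]
    ([minmax_attained]). If [mu < lambda_j], taking the eigenvalues [> mu]
    gives a space of codimension less than [j], which therefore meets every
    space of dimension [j] in a nonzero vector, where the quotient exceeds [mu]
    ([minmax_lower_bound]). *)

(** * Inner products *)

Record inner_product (R : numDomainType) (X : lmodType R) (B : X -> X -> R) :
    Prop := InnerProduct {
  inner_linear : forall a u v w, B (a *: u + v) w = a * B u w + B v w;
  inner_sym : forall u v, B u v = B v u;
  inner_gt0 : forall u, u != 0 -> 0 < B u u
}.

Definition self_adjoint (R : numDomainType) (X : lmodType R) (B : X -> X -> R)
  (T : X -> X) : Prop := forall u v, B (T u) v = B u (T v).

Section InnerProductTheory.
Context {R : numDomainType} {X : lmodType R} {B : X -> X -> R}.
Hypothesis B_inner : inner_product B.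

Lemma innerDl u v w : B (u + v) w = B u w + B v w.
Proof. by have := inner_linear B_inner 1 u v w; rewrite scale1r mul1r. Qed.

Lemma inner0l w : B 0 w = 0.
Proof. by apply: (addrI (B 0 w)); rewrite -innerDl !addr0. Qed.

Lemma innerZl a u w : B (a *: u) w = a * B u w.
Proof. by rewrite -[_ *: _]addr0 (inner_linear B_inner) inner0l addr0. Qed.

Lemma innerNl u w : B (- u) w = - B u w.
Proof. by rewrite -scaleN1r innerZl mulN1r. Qed.

Lemma innerDr u v w : B w (u + v) = B w u + B w v.
Proof. by rewrite ![B w _](inner_sym B_inner) innerDl. Qed.

Lemma innerZr a u w : B w (a *: u) = a * B w u.
Proof. by rewrite ![B w _](inner_sym B_inner) innerZl. Qed.

Lemma innerNr u w : B w (- u) = - B w u.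
Proof. by rewrite ![B w _](inner_sym B_inner) innerNl. Qed.

Lemma inner0r w : B w 0 = 0.
Proof. by rewrite (inner_sym B_inner) inner0l. Qed.

Lemma inner_eq0 u : (B u u == 0) = (u == 0).
Proof.
apply/idP/idP => [|/eqP->]; last by rewrite inner0l.
by apply: contraTT => /(inner_gt0 B_inner)/gt_eqF->.
Qed.

Lemma inner_ge0 u : 0 <= B u u.
Proof.
by have [->|/(inner_gt0 B_inner)/ltW//] := eqVneq u 0; rewrite inner0l.
Qed.

End InnerProductTheory.

(** * Diagonalization of self-adjoint real matrices *)

Section SelfAdjointMatrix.
Context {R : rcfType}.
Local Notation toC := (real_complex R).
Local Notation re := (@complex.Re R).
Local Notation im := (@complex.Im R).

Lemma Re_sum (I : finType) (F : I -> R[i]) :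
  re (\sum_i F i) = \sum_i re (F i).
Proof. by elim/big_rec2: _ => // i _ [a b] _ <-; case: (F i). Qed.

Lemma Im_sum (I : finType) (F : I -> R[i]) :
  im (\sum_i F i) = \sum_i im (F i).
Proof. by elim/big_rec2: _ => // i _ [a b] _ <-; case: (F i). Qed.

Lemma complex_eigenvector n (A : 'M[R]_n) (v : 'rV[R[i]]_n) (z : R[i]) :
  v *m map_mx toC A = z *: v ->
  let u := map_mx re v in let w := map_mx im v in
  u *m A = re z *: u - im z *: w /\
  w *m A = im z *: u + re z *: w.
Proof.
move=> Av u w; split; apply/rowP => j; have /rowP/(_ j) := Av; rewrite !mxE.
  move/(congr1 re); rewrite Re_sum.
  have -> : re (z * v 0 j) = re z * re (v 0 j) - im z * im (v 0 j).
    by case: z {Av} (v 0 j) => a b [].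
  move=> <-; apply: eq_bigr => k _; rewrite !mxE.
  by case: (v 0 k) => a b /=; rewrite mulr0 subr0.
move/(congr1 im); rewrite Im_sum.
have -> : im (z * v 0 j) = im z * re (v 0 j) + re z * im (v 0 j).
  by case: z {Av} (v 0 j) => a b [c d] /=; rewrite addrC.
move=> <-; apply: eq_bigr => k _; rewrite !mxE.
by case: (v 0 k) => a b /=; rewrite mulr0 add0r.
Qed.

(** If [u] and [w] are the real and imaginary parts of an eigenvector for
    [a + i b], comparing [B (u A) w] with [B u (w A)] leaves
    [b (B u u + B w w) = 0], and the second factor is positive. *)
Lemma self_adjoint_eigenvalue_real n (B : 'rV[R]_n -> 'rV[R]_n -> R)
    (A : 'M[R]_n) (z : R[i]) :
  inner_product B -> self_adjoint B (mulmx^~ A) ->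
  eigenvalue (map_mx toC A) z -> im z = 0.
Proof.
move=> Bi A_adj /eigenvalueP[v /complex_eigenvector[]].
set u := map_mx _ v; set w := map_mx _ v => Au Aw v0.
have := A_adj u w; rewrite Au Aw (innerDl Bi) (innerDr Bi) (innerNl Bi).
rewrite !(innerZl Bi, innerZr Bi) addrC => /addIr/eqP.
rewrite eq_sym -subr_eq0 opprK -mulrDr mulf_eq0 => /orP[/eqP//|].
rewrite paddr_eq0 ?(inner_ge0 Bi)// !(inner_eq0 Bi) => /andP[/eqP u0 /eqP w0].
case/eqP: v0; apply/rowP => j; rewrite mxE.
have /rowP/(_ j) := u0; have /rowP/(_ j) := w0; rewrite !mxE.
by case: (v 0 j) => a b /= -> ->.
Qed.

(** [B (T u) (T u) = B u (T (T u)) = 0]. *)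
Lemma self_adjoint_square_eq0 (X : lmodType R) (B : X -> X -> R) (T : X -> X)
    u :
  inner_product B -> self_adjoint B T -> T (T u) = 0 -> T u = 0.
Proof.
move=> Bi T_adj TTu; apply/eqP.
by rewrite -(inner_eq0 Bi) T_adj TTu (inner0r Bi).
Qed.

Lemma self_adjoint_horner_square n (B : 'rV[R]_n.+1 -> 'rV[R]_n.+1 -> R)
    (A : 'M[R]_n.+1) (r : R) (p : {poly R}) :
  inner_product B -> self_adjoint B (mulmx^~ A) ->
  horner_mx A (('X - r%:P) ^+ 2 * p) = 0 -> horner_mx A (('X - r%:P) * p) = 0.
Proof.
move=> Bi A_adj Ap0; apply/row_matrixP => i; rewrite rowE mulrC rmorphM /=.
pose T (v : 'rV_n.+1) := v *m (A - r%:M).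
have TE : horner_mx A ('X - r%:P) = A - r%:M.
  by rewrite rmorphB /= horner_mx_X horner_mx_C.
have T_adj : self_adjoint B T.
  move=> u v; rewrite /T !mulmxBr !mul_mx_scalar (innerDl Bi) (innerDr Bi).
  by rewrite (innerNl Bi) (innerNr Bi) (innerZl Bi) (innerZr Bi) A_adj.
rewrite TE mulmxA row0 -/(T _); apply: (self_adjoint_square_eq0 Bi T_adj).
by rewrite /T -!mulmxA -TE !mulmxE -!rmorphM mulrC -expr2 /= Ap0 mulmx0.
Qed.

(** Repeated linear factors of an annihilating polynomial can be dropped one
    at a time. The cofactor [p] makes the induction on [rs] work: it collects
    the factors that have already been treated. *)
Lemma self_adjoint_horner_undup n (B : 'rV[R]_n.+1 -> 'rV[R]_n.+1 -> R)
    (A : 'M[R]_n.+1) (rs : seq R) (p : {poly R}) :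
  inner_product B -> self_adjoint B (mulmx^~ A) ->
  horner_mx A ((\prod_(r <- rs) ('X - r%:P)) * p) = 0 ->
  horner_mx A ((\prod_(r <- undup rs) ('X - r%:P)) * p) = 0.
Proof.
move=> Bi A_adj; elim: rs p => [//|r rs IHrs] p /=.
rewrite big_cons; case: ifPn => [r_rs|_]; last first.
  have swap s : ('X - r%:P) * s * p = s * (('X - r%:P) * p).
    by rewrite -mulrA mulrCA.
  by rewrite big_cons !swap; apply: IHrs.
rewrite (perm_big _ (perm_to_rem r_rs)) big_cons mulrA -expr2 -mulrA.
move=> /(self_adjoint_horner_square Bi A_adj); rewrite mulrA => Ap0.
by apply: IHrs; rewrite (perm_big _ (perm_to_rem r_rs)) big_cons.
Qed.

Lemma self_adjoint_mx_diagonalizable n (B : 'rV[R]_n -> 'rV[R]_n -> R)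
    (A : 'M[R]_n) :
  inner_product B -> self_adjoint B (mulmx^~ A) -> diagonalizable A.
Proof.
case: n => [|n] in B A *; first by rewrite thinmx0 => *; exact: diagonalizable0.
move=> Bi A_adj; apply: (proj2 (diagonalizableP _)).
have [zs] := closed_field_poly_normal (map_poly toC (mxminpoly A)).
rewrite (monicP _) ?map_monic ?mxminpoly_monic// scale1r => minE.
have zs_real z : z \in zs -> z = toC (re z).
  move=> zs_z; have /(self_adjoint_eigenvalue_real Bi A_adj) :
      eigenvalue (map_mx toC A) z.
    rewrite eigenvalue_root_char -root_mxminpoly mxminpoly_map minE.
    by rewrite root_prod_XsubC.
  by case: z {zs_z} => a b /= ->.
have {minE}minE : mxminpoly A = \prod_(r <- map re zs) ('X - r%:P).
  apply: (map_poly_inj (real_complex R : {rmorphism R -> R[i]})).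
  rewrite minE rmorph_prod big_map; apply: eq_big_seq => z /zs_real zE.
  by rewrite /= rmorphB/= map_polyX map_polyC/= -zE.
exists (undup (map re zs)); first exact: undup_uniq.
apply: mxminpoly_min; rewrite -[\prod_(_ <- _) _]mulr1.
apply: (self_adjoint_horner_undup Bi A_adj).
by rewrite mulr1 -minE mx_root_minpoly.
Qed.

End SelfAdjointMatrix.

(** * Eigenspaces of self-adjoint endomorphisms *)

Section SelfAdjointEnd.
Context {R : rcfType} {X : vectType R} {B : X -> X -> R} {T : 'End(X)}.
Hypotheses (B_inner : inner_product B) (T_adj : self_adjoint B T).

Lemma leigenspaceP r v : reflect (T v = r *: v) (v \in leigenspace T r).
Proof. by rewrite memv_ker !lfun_simp subr_eq0; apply: eqP. Qed.

(** The matrix statement applies to the matrix of [T] in an arbitrary basis,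
    orthonormal or not, because the inner product is transported along. *)
Lemma leigenspace_total :
  exists2 rs, uniq rs & (\sum_(r <- rs) leigenspace T r)%VS = fullv.
Proof.
have e_basis := vbasisP (@fullv R X); set e := vbasis _ in e_basis.
pose B' (u v : 'rV[R]_(\dim (@fullv R X))) := B (vecof e u) (vecof e v).
have B'_inner : inner_product B'.
  split=> [a u v w|u v|u u0]; rewrite /B'.
  - by rewrite linearP (inner_linear B_inner).
  - exact: (inner_sym B_inner).
  - by apply: (inner_gt0 B_inner); rewrite vecof_eq0.
have T_adj' : self_adjoint B' (mulmx^~ (mxof e e T)).
  by move=> u v; rewrite /B' -!hom_vecof// T_adj.
have /diagonalizablePeigen[rs rs_uniq sumE] :=
  self_adjoint_mx_diagonalizable B'_inner T_adj'.
exists rs => //; apply/eqP; rewrite eqEsubv subvf; apply/subvP => v _.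
rewrite (big_nth 0) big_mkord.
have := submx1 (rVof e v); rewrite -sumE (big_nth 0) big_mkord.
move=> /sub_sumsmxP[u vE].
rewrite -(rVofK e_basis v) vE linear_sum /=.
apply: memv_sumr => i _; rewrite (leigenspaceE e_basis) -rVof_sub// vecofK//.
exact: submxMl.
Qed.

(** For [T u = r u] and [T w = s w], self-adjointness gives
    [(r - s) B u w = 0]. *)
Lemma leigenspace_sum_orthogonal r rs u v : r \notin rs ->
  u \in leigenspace T r -> v \in (\sum_(s <- rs) leigenspace T s)%VS ->
  B u v = 0.
Proof.
move=> r_rs /leigenspaceP Tu; elim: rs r_rs v => [|s rs IHrs] r_rs v.
  by rewrite big_nil memv0 => /eqP->; rewrite (inner0r B_inner).
move: r_rs; rewrite inE negb_or => /andP[r_s r_rs].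
rewrite big_cons => /memv_addP[w /leigenspaceP Tw [w' w'_rs ->]].
rewrite (innerDr B_inner) (IHrs r_rs _ w'_rs) addr0; apply/eqP.
have := T_adj u w; rewrite Tu Tw (innerZl B_inner) (innerZr B_inner) => /eqP.
by rewrite -subr_eq0 -mulrBl mulf_eq0 subr_eq0 (negPf r_s).
Qed.

Lemma dimv_leigenspace_sum rs : uniq rs ->
  \dim (\sum_(r <- rs) leigenspace T r) =
    (\sum_(r <- rs) \dim (leigenspace T r))%N.
Proof.
elim: rs => [|r rs IHrs] /=; first by rewrite !big_nil dimv0.
move=> /andP[r_rs /IHrs dimE]; rewrite !big_cons -dimE dimv_disjoint_sum//.
apply/eqP; rewrite -subv0; apply/subvP => v; rewrite memv_cap => /andP[vr vrs].
by rewrite memv0 -(inner_eq0 B_inner) (leigenspace_sum_orthogonal r_rs).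
Qed.

(** The induction step of the two bounds below: splitting off one eigenspace
    leaves no cross terms. *)
Lemma quadratic_form_leigenspaceD r rs u v : r \notin rs ->
  u \in leigenspace T r -> v \in (\sum_(s <- rs) leigenspace T s)%VS ->
  B (u + v) (u + v) = B u u + B v v /\
  B (u + v) (T (u + v)) = r * B u u + B v (T v).
Proof.
move=> r_rs u_r v_rs; have uv := leigenspace_sum_orthogonal r_rs u_r v_rs.
have vu : B v u = 0 by rewrite (inner_sym B_inner).
have /leigenspaceP Tu := u_r.
rewrite linearD /= !(innerDl B_inner) !(innerDr B_inner) -(T_adj u v) Tu.
by rewrite !(innerZl B_inner) !(innerZr B_inner) uv vu mulr0 !(add0r, addr0).
Qed.

Lemma quadratic_form_le mu rs v : uniq rs -> {in rs, forall r, r <= mu} ->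
  v \in (\sum_(r <- rs) leigenspace T r)%VS -> B v (T v) <= mu * B v v.
Proof.
elim: rs v => [|r rs IHrs] v /=.
  by rewrite big_nil memv0 => _ _ /eqP->; rewrite !(inner0l B_inner) mulr0.
move=> /andP[r_rs rs_uniq] le_mu; rewrite big_cons.
move=> /memv_addP[u u_r [w w_rs ->]].
have [-> ->] := quadratic_form_leigenspaceD r_rs u_r w_rs.
rewrite mulrDr lerD ?ler_wpM2r ?(inner_ge0 B_inner) ?le_mu ?mem_head//.
by apply: IHrs => // s s_rs; apply: le_mu; rewrite inE s_rs orbT.
Qed.

Lemma quadratic_form_gt mu rs v : uniq rs -> {in rs, forall r, mu < r} ->
  v \in (\sum_(r <- rs) leigenspace T r)%VS -> v != 0 ->
  mu * B v v < B v (T v).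
Proof.
elim: rs v => [|r rs IHrs] v /=; first by rewrite big_nil memv0 => _ _ ->.
move=> /andP[r_rs rs_uniq] gt_mu; rewrite big_cons.
move=> /memv_addP[u u_r [w w_rs ->]].
have [-> ->] := quadratic_form_leigenspaceD r_rs u_r w_rs.
have r_mu : mu < r by apply: gt_mu; rewrite mem_head.
have {IHrs} w_gt : w != 0 -> mu * B w w < B w (T w).
  by apply: IHrs => // s s_rs; apply: gt_mu; rewrite inE s_rs orbT.
rewrite mulrDr; have [->|u0 _] := eqVneq u 0.
  by rewrite add0r (inner0l B_inner) !mulr0 !add0r.
apply: ltr_leD; first by rewrite ltr_pM2r ?(inner_gt0 B_inner).
by have [->|/w_gt/ltW//] := eqVneq w 0; rewrite !(inner0l B_inner) mulr0.
Qed.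

End SelfAdjointEnd.

(** * The min-max principle *)

Lemma sum_count_mem_undup (I : eqType) (s : seq I) :
  (\sum_(x <- undup s) count_mem x s = size s)%N.
Proof.
rewrite -(perm_size (perm_count_undup s)) size_flatten /shape -map_comp.
by rewrite sumnE big_map; apply: eq_bigr => x _; rewrite /= size_nseq.
Qed.

Lemma subspace_of_dim (F : fieldType) (X : vectType F) (W : {vspace X}) k :
  (k <= \dim W)%N -> exists2 Y : {vspace X}, (Y <= W)%VS & \dim Y = k.
Proof.
move=> k_le; exists <<take k (vbasis W)>>%VS.
  apply/span_subvP => v /mem_take v_in; exact: vbasis_mem.
have /eqP -> : free (take k (vbasis W)).
  apply: (@catl_free _ _ (drop k (vbasis W))); rewrite cat_take_drop.
  exact: basis_free (vbasisP W).
by rewrite size_takel// size_tuple.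
Qed.

Section SpectrumList.
Context {R : rcfType} {X : vectType R}.

Definition spectrum_list (T : 'End(X)) (lam : seq R) : Prop :=
  [/\ sorted <=%R lam, size lam = \dim {:X} &
      forall mu : R, count_mem mu lam = \dim (leigenspace T mu)].

Variables (B : X -> X -> R) (T : 'End(X)).
Hypotheses (B_inner : inner_product B) (T_adj : self_adjoint B T).

(** Repeat each eigenvalue as often as the dimension of its eigenspace, and
    sort. A number outside [rs] has a zero eigenspace, since its eigenspace is
    independent of the others and these already fill [X]. *)
Lemma spectrum_list_exists : exists lam, spectrum_list T lam.
Proof.
have [rs rs_uniq rs_total] := leigenspace_total B_inner T_adj.
have dim_total : (\sum_(r <- rs) \dim (leigenspace T r) = \dim {:X})%N.
  by rewrite -(dimv_leigenspace_sum B_inner T_adj rs_uniq) rs_total.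
exists (sort <=%R (flatten [seq nseq (\dim (leigenspace T r)) r | r <- rs])).
split; first exact: sort_le_sorted.
  rewrite size_sort size_flatten /shape -map_comp sumnE big_map -dim_total.
  by apply: eq_bigr => r _; rewrite /= size_nseq.
move=> mu; rewrite count_sort count_flatten -map_comp sumnE big_map.
under eq_bigr do rewrite /= count_nseq /=.
have [mu_rs|mu_rs] := boolP (mu \in rs).
  rewrite (bigD1_seq mu)//= eqxx mul1n big1 ?addn0// => r /negPf r_mu.
  by rewrite r_mu.
rewrite big_seq big1 => [|r r_rs]; last first.
  by case: eqP mu_rs => // <-; rewrite r_rs.
have := dimvS (subvf (\sum_(r <- mu :: rs) leigenspace T r)%VS).
rewrite (dimv_leigenspace_sum B_inner T_adj) /= ?mu_rs// big_cons dim_total.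
by rewrite -subn_eq0 addnK => /eqP->.
Qed.

Variable lam : seq R.
Hypothesis lam_spec : spectrum_list T lam.

Lemma dim_leigenspace_count (P : pred R) :
  \dim (\sum_(r <- undup (filter P lam)) leigenspace T r) = count P lam.
Proof.
have [_ _ count_lam] := lam_spec.
rewrite (dimv_leigenspace_sum B_inner T_adj) ?undup_uniq// -size_filter.
rewrite -[RHS]sum_count_mem_undup; apply: eq_big_seq => r.
rewrite mem_undup mem_filter => /andP[Pr _]; rewrite -count_lam count_filter.
by apply: eq_count => s /=; case: eqP => // ->; rewrite Pr.
Qed.

(** The first [j] entries of the list are at most its [j]-th one, so the
    eigenspaces for the eigenvalues up to it span at least [j] dimensions. *)
Lemma minmax_attained j : (0 < j <= \dim {:X})%N ->
  exists2 Y : {vspace X}, \dim Y = j &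
    {in Y, forall v, B v (T v) <= lam`_j.-1 * B v v}.
Proof.
move=> /andP[j_gt0 j_le]; have [lam_sorted lam_size _] := lam_spec.
pose P := <= lam`_j.-1.
have j_count : (j <= count P lam)%N.
  have j_size : size (take j lam) = j by rewrite size_takel ?lam_size.
  rewrite -(cat_take_drop j lam) count_cat -[leqLHS]addn0 leq_add//.
  rewrite -{1}j_size leq_eqVlt eq_sym -all_count; apply/orP; left.
  apply/(all_nthP 0) => i; rewrite j_size => i_j; rewrite nth_take//.
  have j1_j : (j.-1 < j)%N by rewrite prednK.
  apply: (le_sorted_leq_nth _ lam_sorted); rewrite ?inE ?lam_size.
  - exact: leq_trans j_le.
  - exact: leq_trans j_le.
  - by rewrite -ltnS prednK.
rewrite -dim_leigenspace_count in j_count.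
have [Y /subvP YW dimY] := subspace_of_dim j_count.
exists Y => // v /YW; apply: (quadratic_form_le B_inner T_adj).
  exact: undup_uniq.
by move=> r; rewrite mem_undup mem_filter => /andP[].
Qed.

(** Otherwise all entries from the [\dim Y]-th on exceed [mu]; their
    eigenspaces span a space [Z] with [\dim Y + \dim Z > \dim X], and a
    nonzero vector of the intersection violates the bound. *)
Lemma minmax_lower_bound (Y : {vspace X}) mu : (0 < \dim Y)%N ->
  {in Y, forall v, v != 0 -> B v (T v) <= mu * B v v} ->
  lam`_(\dim Y).-1 <= mu.
Proof.
move=> Y_gt0 le_mu; have [lam_sorted lam_size _] := lam_spec.
rewrite leNgt; apply/negP => mu_lt; pose P := > mu.
pose Z := (\sum_(r <- undup (filter P lam)) leigenspace T r)%VS.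
have Y_le : (\dim Y <= size lam)%N by rewrite lam_size dimvS// subvf.
have Z_ge : (size lam - (\dim Y).-1 <= \dim Z)%N.
  rewrite dim_leigenspace_count -(cat_take_drop (\dim Y).-1 lam) count_cat.
  rewrite cat_take_drop -size_drop -[leqLHS]add0n leq_add//.
  rewrite leq_eqVlt eq_sym -all_count; apply/orP; left; apply/(all_nthP 0) => i.
  rewrite size_drop ltn_subRL nth_drop => i_lt; apply: lt_le_trans mu_lt _.
  apply: (le_sorted_leq_nth _ lam_sorted); rewrite ?inE ?leq_addr//.
  by rewrite prednK.
have : (0 < \dim (Y :&: Z))%N.
  rewrite -(ltn_add2l (\dim (Y + Z))) addn0 dimv_sum_cap.
  apply: (@leq_ltn_trans (size lam)); first by rewrite lam_size dimvS// subvf.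
  lia.
rewrite lt0n dimv_eq0 -vpick0 => v_neq0.
have /memv_capP[v_Y v_Z] := memv_pick (Y :&: Z)%VS.
pose v := vpick (Y :&: Z)%VS.
suff : mu * B v v < B v (T v) by rewrite ltNge le_mu.
apply: (quadratic_form_gt B_inner T_adj _ _ v_Z v_neq0); first exact: undup_uniq.
by move=> r; rewrite mem_undup mem_filter => /andP[].
Qed.

End SpectrumList.

(** * Green's formula with the Neumann condition *)

Section Graph.
Context {R : realType} {V : choiceType} (G : graph V) {S : {fset V}}.

Lemma sum_inS (F : vclosure G S -> R) (P : pred (vclosure G S)) :
  \sum_(x : S | P (inS G x)) F (inS G x) = \sum_(z | P z && (val z \in S)) F z.
Proof.
rewrite (reindex_omap (@inS _ G S) (fun z => insub (val z))) /=.
  apply: eq_bigl => x; rewrite (valP x) andbT.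
  rewrite [X in _ = _ && (X == _)](_ : _ = Some x) ?eqxx ?andbT//.
  exact: valK.
move=> z /andP[_ zS]; rewrite insubT /=; congr Some; exact: val_inj.
Qed.

Definition weighted_inner (f g : {ffun S -> R^o}) : R :=
  gintegral G (fun x => f x * g x).

Lemma weighted_inner_product : (forall x : S, (0 < deg G (val x))%N) ->
  inner_product weighted_inner.
Proof.
move=> deg_gt0; split=> [a f g h|f g|f f0].
- rewrite /weighted_inner /gintegral mulr_sumr -big_split; apply: eq_bigr => x _.
  by rewrite !ffunE /= !mulrDl !mulrA.
- by apply: eq_bigr => x _; rewrite mulrC [f x * _]mulrC mulrC.
have term_ge0 (x : S) : true -> 0 <= f x * f x * (deg G (val x))%:R :> R.
  by move=> _; rewrite mulr_ge0 ?ler0n// -expr2 sqr_ge0.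
rewrite lt_def sumr_ge0// andbT; apply: contra f0 => /eqP sum0.
apply/eqP/ffunP => x; have /eqP := @psumr_eq0P _ _ _ _ term_ge0 sum0 x isT.
rewrite ffunE mulf_eq0 pnatr_eq0 eqn0Ngt deg_gt0 orbF mulf_eq0 orbb.
by move/eqP.
Qed.

(** Both arguments are replaced by their Neumann extensions, after which the
    Laplacian part becomes the form [D] below, symmetric by the exchange of the
    two vertices of a pair. *)
Lemma schrodinger_self_adjoint (Q : vclosure G S -> R) :
  (forall x : S, (0 < deg G (val x))%N) ->
  self_adjoint weighted_inner (schrodinger Q).
Proof.
move=> deg_gt0.
(* Pairs with both vertices in the boundary are left out: the Laplacian on [S]
   and the Neumann condition only see edges with a vertex in [S]. *)
pose touches (u v : vclosure G S) :=
  (val v \in nbrs G (val u)) && ((val u \in S) || (val v \in S)).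
pose D (F H : vclosure G S -> R) :=
  \sum_u \sum_(v | touches u v) F u * (H v - H u).
have D_sym F H : D F H = D H F.
  have DE F' H' : D F' H' = \sum_u \sum_(v | touches u v) F' u * H' v -
      \sum_u \sum_(v | touches u v) F' u * H' u.
    rewrite -sumrB; apply: eq_bigr => u _; rewrite -sumrB.
    by apply: eq_bigr => v _; rewrite mulrBr.
  rewrite !DE; congr (_ - _); last first.
    by apply: eq_bigr => u _; apply: eq_bigr => v _; rewrite mulrC.
  rewrite (exchange_big_dep predT)//=; apply: eq_bigr => v _.
  apply: eq_big => u; last by rewrite mulrC.
  by rewrite /touches nbrs_sym orbC.
have innerE f g : weighted_inner f (schrodinger Q g) =
    - D (neumann_ext G f) (neumann_ext G g) +
    gintegral G (fun x => Q (inS G x) * f x * g x).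
  rewrite /weighted_inner /gintegral.
  have [fS fN] := neumann_extP G f; have [gS gN] := neumann_extP G g.
  set F := neumann_ext G f in fS fN *; set H := neumann_ext G g in gS gN *.
  have -> : D F H = \sum_(x : S) \sum_(v | touches (inS G x) v)
      F (inS G x) * (H v - H (inS G x)).
    rewrite (sum_inS (fun u => \sum_(v | touches u v) F u * (H v - H u)) predT).
    (* The boundary vertices contribute nothing, by the Neumann condition. *)
    rewrite /D (bigID (fun z => val z \in S)) /= [X in _ + X]big1 ?addr0//.
    move=> u uS; rewrite -mulr_sumr.
    have [x uE] : exists x : vboundary G S, u = inB x.
      by have [[x uE]|//] := closureP u; rewrite uE (valP x) in uS.
    rewrite (eq_bigl (fun v => (val v \in nbrs G (val u)) && (val v \in S))).
      rewrite -(sum_inS (fun v => H v - H u) (fun v => val v \in nbrs G (val u))).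
      by rewrite uE gN mulr0.
    by move=> v; rewrite /touches (negPf uS).
  rewrite -sumrN -big_split /=; apply: eq_bigr => x _.
  rewrite -mulr_sumr (eq_bigl (fun v => val v \in nbrs G (val x))); last first.
    by move=> v; rewrite /touches /= (valP x) andbT.
  have deg_neq0 : (deg G (val x))%:R != 0 :> R by rewrite pnatr_eq0 -lt0n.
  rewrite ffunE fS mulrDr mulrDl mulrN mulNr; congr (- _ + _).
    by rewrite /laplacian -/H mulrCA mulrC mulVKf.
  by rewrite mulrCA mulrA.
move=> f g; have sym h k : weighted_inner h k = weighted_inner k h.
  by apply: eq_bigr => x _; rewrite [h x * _]mulrC.
rewrite sym !innerE D_sym; congr (_ + _).
by apply: eq_bigr => x _; rewrite -!mulrA [g x * _]mulrCA [g x * _]mulrC.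
Qed.

End Graph.

(** * Level sets of the energy *)

(** A vertex of degree zero has no neighbour, so connectedness makes it the
    only vertex of [S], and the integral reduces to a term of weight zero. *)
Lemma deg_gt0_of_gintegral (R : realType) (V : choiceType) (G : graph V)
    (S : {fset V}) (q : S -> R) :
  induced_connected G S -> gintegral G q != 0 ->
  forall x : S, (0 < deg G (val x))%N.
Proof.
move=> S_conn q_neq0 x; rewrite lt0n; apply: contra q_neq0 => /eqP deg0.
apply/eqP; rewrite /gintegral big1// => y _.
have /connectP[[|z p] /= xp ->] := S_conn x y; first by rewrite deg0 mulr0.
have /cardfs0_eq nbrs0 : #|` nbrs G (val x)| = 0%N by [].
by move: xp; rewrite nbrs0 in_fset0.
Qed.

(** Invariance of [A'] under scaling is what allows to pass from a class to
    any of its representatives. *)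
Lemma proj_image_subset (F : fieldType) (X : vectType F) (A A' : set X) :
  (forall a f, a != 0 -> A' f -> A' (a *: f)) ->
  proj_image A `<=` proj_image A' <-> forall f, A f -> f != 0 -> A' f.
Proof.
move=> A'_scale; split=> [sub f Af f0|sub _ [f [Af f0] <-]]; last first.
  by exists f => //; split=> //; apply: sub.
have [|g [A'g g0] gf] := sub (proj_class f); first by exists f.
have : proj_class f f by exists 1; rewrite ?oner_neq0 ?scale1r.
by rewrite -gf => -[a a0 ->]; apply: A'_scale.
Qed.

Section EnergyLevels.
Context {R : realType} {V : choiceType} {G : graph V} {S : {fset V}}.
Variable Q : vclosure G S -> R.
Hypothesis deg_gt0 : forall x : S, (0 < deg G (val x))%N.

Let inner := weighted_inner_product (R := R) deg_gt0.

Lemma energyE f :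
  energy Q f =
  weighted_inner G f (linfun (schrodinger Q) f) / weighted_inner G f f.
Proof. by rewrite lfunE. Qed.

Lemma energy_scale a f : a != 0 -> energy Q (a *: f) = energy Q f.
Proof.
move=> a0; rewrite !energyE linearZ /= !(innerZl inner) !(innerZr inner) !mulrA.
by rewrite -mulf_div divff ?mul1r// mulf_neq0.
Qed.

Lemma energy_le f mu : f != 0 -> (energy Q f <= mu) =
  (weighted_inner G f (linfun (schrodinger Q) f) <= mu * weighted_inner G f f).
Proof. by move=> f0; rewrite energyE ler_pdivrMr// (inner_gt0 inner). Qed.

Lemma proj_subspace_level_setP k mu :
  (exists2 P : set (set {ffun S -> R^o}),
     is_proj_subspace k P & P `<=` level_set Q mu) <->
  exists2 Y : {vspace {ffun S -> R^o}}, \dim Y = k.+1 &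
    {in Y, forall f, f != 0 ->
      weighted_inner G f (linfun (schrodinger Q) f) <=
      mu * weighted_inner G f f}.
Proof.
have scale a f : a != 0 -> energy Q f <= mu -> energy Q (a *: f) <= mu.
  by move=> a0; rewrite energy_scale.
split=> [[_ [Y dimY ->] /(proj_image_subset _ scale) le_mu]|[Y dimY le_mu]].
  by exists Y => // f fY f0; rewrite -energy_le//; apply: le_mu.
exists (proj_image [set f | f \in Y]); first by exists Y.
apply/(proj_image_subset _ scale) => f fY f0.
by rewrite /= energy_le//; apply: le_mu.
Qed.

Lemma eigenvalue_listE lam :
  eigenvalue_list Q lam <-> spectrum_list (linfun (schrodinger Q)) lam.
Proof.
have dimX : \dim {: {ffun S -> R^o}} = #|` S|.
  by rewrite dimvf /dim /= muln1 cardfE.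
by rewrite /spectrum_list dimX.
Qed.

End EnergyLevels.

Theorem theorem9 (R : realType) (V : choiceType) (G : graph V) (S : {fset V})
    (Q : vclosure G S -> R) :
  infinite_set [set: V] ->
  locally_finite G ->
  induced_connected G S ->
  gintegral G (fun x : S => Q (inS G x)) != 0 ->
  (exists lam : seq R, eigenvalue_list Q lam) /\
  (forall lam : seq R, eigenvalue_list Q lam ->
   forall j : nat, (1 <= j <= #|` S|)%N ->
   let A := [set mu : R | exists2 P : set (set {ffun S -> R^o}),
               is_proj_subspace j.-1 P & P `<=` level_set Q mu] in
   A lam`_j.-1 /\ lbound A lam`_j.-1).
Proof.
move=> _ _ S_conn /(deg_gt0_of_gintegral S_conn) deg_gt0.
have inner := weighted_inner_product (R := R) deg_gt0.
have adj : self_adjoint (weighted_inner G) (linfun (schrodinger Q)).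
  by move=> f g; rewrite !lfunE; apply: schrodinger_self_adjoint.
split.
  have [lam lam_spec] := spectrum_list_exists inner adj.
  by exists lam; apply/eigenvalue_listE.
move=> lam lam_eig j j_in A.
have lam_spec := (eigenvalue_listE Q lam).1 lam_eig.
have [_ lam_size _] := lam_eig; have [_ lam_size' _] := lam_spec.
rewrite -lam_size lam_size' in j_in; have /andP[j_gt0 _] := j_in.
split=> [|mu /(proj_subspace_level_setP Q deg_gt0)[Y dimY le_mu]].
  apply/(proj_subspace_level_setP Q deg_gt0).
  have [Y dimY le_lam] := minmax_attained inner adj lam_spec j_in.
  by exists Y => [|f fY _]; [rewrite dimY prednK|apply: le_lam].
have := minmax_lower_bound inner adj lam_spec _ le_mu.
by rewrite dimY; apply.
Qed.
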